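(* For every integer $n \ge 2$, the number of compositions of $n$ with all parts at least two is the $(n-1)$st Fibonacci number, i.e., $c_{\hat{1}}(n) = F_{n-1}$.
   Context: The Fibonacci sequence is defined by $F_0 = 0$, $F_1 = 1$, and $F_n = F_{n-1}+F_{n-2}$ for $n \ge 2$. Given a positive integer $n$, a composition of $n$ is an ordered collection (finite sequence) of positive integers, called parts, whose sum is $n$; different orders count as different compositions. $C_{\hat{1}}(n)$ denotes the set of compositions of $n$ all of whose parts are at least two, and $c_{\hat{1}}(n) = |C_{\hat{1}}(n)|$. *)

(* Defs.v *)
From HB Require Import structures.
From mathcomp Require Import all_boot.

Set Implicit Arguments.
Unset Strict Implicit.
Unset Printing Implicit Defensive.

Fixpoint fib (n : nat) : nat :=
  match n with
  | 0 => 0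
  | m.+1 => match m with
            | 0 => 1
            | k.+1 => fib m + fib k
            end
  end.

Definition is_composition (n : nat) (s : seq nat) : bool :=
  all (fun p => 0 < p) s && (sumn s == n).

(* For n = 0 the only inhabitant is the empty sequence. *)
Record composition (n : nat) : Type := Composition {
  parts :> seq nat;
  _ : is_composition n parts
}.

HB.instance Definition _ (n : nat) := [isSub for @parts n].
HB.instance Definition _ (n : nat) := [Countable of composition n by <:].

Lemma composition_part_le (n : nat) (c : composition n) (p : nat) :
  p \in parts c -> p <= n.
Proof.
case: c => s /= /andP[_ /eqP <-]; elim: s => //= q s IHs.
rewrite inE => /predU1P[->|/IHs le_ps]; first exact: leq_addr.
exact: leq_trans le_ps (leq_addl _ _).
Qed.

Lemma composition_size_le (n : nat) (c : composition n) : size (parts c) <= n.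
Proof.
case: c => s /= /andP[s_gt0 /eqP <-]; elim: s s_gt0 => //= q s IHs.
by case/andP=> q_gt0 /IHs le_s; rewrite -add1n leq_add.
Qed.

(* Finiteness: a composition of n has at most n parts, each at most n, so it
   embeds into the sequences of length at most n over 'I_n.+1. *)
Definition composition_code (n : nat) (c : composition n) : n.-bseq 'I_n.+1 :=
  insub_bseq n [seq inord p | p <- parts c].

Definition composition_decode (n : nat) (b : n.-bseq 'I_n.+1) :
  option (composition n) := insub [seq val i | i <- b].

Lemma composition_codeK (n : nat) :
  pcancel (@composition_code n) (@composition_decode n).
Proof.
move=> c; rewrite /composition_decode /composition_code /insub_bseq val_insubd.
rewrite size_map composition_size_le -map_comp.
rewrite (_ : map _ _ = val c) ?valK // -[RHS]map_id.
by apply/eq_in_map => p /composition_part_le le_pn /=; rewrite inordK.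
Qed.

HB.instance Definition _ (n : nat) :=
  isFinite.Build (composition n) (pcan_enumP (@composition_codeK n)).

(* The hat 1 in the names says that the part 1 is excluded. *)
Definition C_hat1 (n : nat) : {set composition n} :=
  [set c : composition n | all (fun p => 1 < p) (parts c)].

Definition c_hat1 (n : nat) : nat := #|C_hat1 n|.

(* Main.v *)
Require Import Defs.
From mathcomp Require Import all_boot.

(** Sort the compositions of n + 2 without part 1 by their first part.  If it
    is 2, removing it leaves such a composition of n; if it exceeds 2, lowering
    it by one leaves such a composition of n + 1.  Both operations are
    invertible, so the counts satisfy the Fibonacci recurrence, and it remains
    to compare the two initial values.  The argument is carried out on an
    explicit list, [no1_compositions n], built by the two inverse operations:
    [mem_no1_compositions] shows that it is complete, [no1_compositions_uniq]
    that it has no repetitions, so that its length is the wanted count. *)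

(** The value at the empty sequence makes this map injective on all sequences,
    so that no nonemptiness condition is needed to map it over a list. *)
Definition grow_head (s : seq nat) : seq nat :=
  if s is p :: t then p.+1 :: t else [::].

Fixpoint no1_compositions (n : nat) : seq (seq nat) :=
  match n with
  | 0 => [:: [::]]
  | m.+1 => match m with
            | 0 => [::]
            | k.+1 => map (cons 2) (no1_compositions k)
                      ++ map grow_head (no1_compositions m)
            end
  end.

Lemma no1_compositionsSS n :
  no1_compositions n.+2 =
  map (cons 2) (no1_compositions n) ++ map grow_head (no1_compositions n.+1).
Proof. by []. Qed.

Lemma grow_head_inj : injective grow_head.
Proof. by move=> [|p s] [|q t] //= [-> ->]. Qed.

Lemma cons_inj (T : Type) (x : T) : injective (cons x).
Proof. by move=> s t []. Qed.

Lemma map_consE (T : eqType) (x y : T) (s : seq T) (l : seq (seq T)) :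
  (y :: s \in map (cons x) l) = (y == x) && (s \in l).
Proof.
case: eqVneq => [-> | neq_yx] /=; first by rewrite (mem_map (@cons_inj _ x)).
by apply/mapP => -[t _ [/eqP]]; rewrite (negPf neq_yx).
Qed.

Lemma mem_no1_compositions n s :
  (s \in no1_compositions n) = all (fun p => 1 < p) s && (sumn s == n).
Proof.
(* The recursion has depth two, hence two consecutive ranks at a time. *)
suff: forall m, (forall s, (s \in no1_compositions m)
                   = all (fun p => 1 < p) s && (sumn s == m))
             /\ (forall s, (s \in no1_compositions m.+1)
                   = all (fun p => 1 < p) s && (sumn s == m.+1)).
  by move=> /(_ n)[->].
elim=> [|m [IH0 IH1]]; first by split=> [] [|[|[|p]] t] //=; rewrite andbF.
split=> // -[|[|q] t]; rewrite no1_compositionsSS mem_cat.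
- apply/negbTE; rewrite negb_or; apply/andP; split; first by apply/mapP => -[].
  by rewrite -[[::]]/(grow_head [::]) (mem_map grow_head_inj) IH1.
- by rewrite map_consE /=; apply/mapP => -[[|p u]].
rewrite map_consE -[q.+1 :: t in X in _ || X]/(grow_head (q :: t)).
rewrite (mem_map grow_head_inj) IH0 IH1 /= addSn eqSS.
by case: q => [|[|q]] //=; rewrite orbF add1n eqSS.
Qed.

(** The two families are disjoint: growing a head that is at least 2 never
    yields 2. *)
Lemma no1_compositions_uniq n : uniq (no1_compositions n).
Proof.
suff: forall m, uniq (no1_compositions m) && uniq (no1_compositions m.+1).
  by move=> /(_ n)/andP[].
elim=> // m /andP[U0 U1]; rewrite U1 no1_compositionsSS cat_uniq.
rewrite (map_inj_uniq (@cons_inj _ 2)) (map_inj_uniq grow_head_inj) U0 U1.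
rewrite andbT; apply/hasPn => _ /mapP[s + ->].
rewrite mem_no1_compositions; case: s => [|p s] /=.
  by move=> _; apply/mapP => -[].
by case/andP=> /andP[p_gt1 _] _; rewrite map_consE eqSS gtn_eqF.
Qed.

Lemma size_no1_compositions n : size (no1_compositions n.+2) = fib n.+1.
Proof.
suff: forall m, size (no1_compositions m.+2) = fib m.+1
             /\ size (no1_compositions m.+3) = fib m.+2 by move=> /(_ n)[].
elim=> // m [IH0 IH1]; split=> //.
by rewrite no1_compositionsSS size_cat !size_map IH0 IH1 addnC.
Qed.

Lemma c_hat1_size n : c_hat1 n = size (no1_compositions n).
Proof.
rewrite /c_hat1 cardE -(size_map (@parts n)); apply: perm_size.
apply: uniq_perm (no1_compositions_uniq n) _ => [|s].
  by rewrite (map_inj_uniq val_inj) enum_uniq.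
rewrite mem_no1_compositions; apply/mapP/andP => [[c + ->] | [s_gt1 sum_s]].
  by rewrite mem_enum inE; case: c => t /= /andP[].
have s_comp : is_composition n s.
  by rewrite /is_composition sum_s andbT (sub_all _ s_gt1) // => p /ltnW.
by exists (Composition s_comp); rewrite // mem_enum inE.
Qed.

Theorem proposition3 (n : nat) (hn : 2 <= n) : c_hat1 n = fib (n - 1).
Proof.
case: n hn => [|[|n]] // _.
by rewrite c_hat1_size size_no1_compositions subn1.
Qed.
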